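(* Let $Z:I^n\to\mathbb{R}^c$ be the logit map of a ReLU network, let $x_0\in I^n$ with $t:=\kappa(x_0)\in\{1,\dots,c\}$, and let $F(x)=\|x-x_0\|_2^2+a\,f(x)$ with $f(x)=\max\{Z_t(x)-\max_{i\neq t}Z_i(x),\,0\}$ and $a>0$ sufficiently large. Then any successful CW attack converges to a stationary point of $F$ on the boundary $\partial\mathcal{F}$ of the feasible set. That is: if $(x_k)_{k\ge0}$ is a CW attack sequence starting at $x_0$ that converges to a point $x^*$ with $x^*\notin\mathcal{NF}$, then $x^*$ is a stationary point of $F$ and $x^*\in\partial\mathcal{F}$.
   Context: $I=[0,1]$, $n\ge1$, $c\ge2$. A ReLU network gives a continuous map $Z=(Z_1,\dots,Z_c):I^n\to\mathbb{R}^c$ (the logits) such that $I^n$ is a union of finitely many convex polytopes with $Z$ affine on each. The full network is $\varphi=\mathrm{softmax}\circ Z$. The class map is $\kappa(x)=i$ if $\varphi_i(x)>\varphi_j(x)$ for all $j\ne i$ (equivalently $Z_i(x)>Z_j(x)$ for all $j\ne i$), and $\kappa(x)=0$ if no such $i$ exists. The feasible region is $\mathcal{F}=\{x\in I^n:\kappa(x)\ne t\}$, the infeasible region is $\mathcal{NF}=\{x\in I^n:\kappa(x)=t\}$, and $\partial\mathcal{F}=\partial\mathcal{NF}$ is the class boundary between them (boundary taken relative to $I^n$). For a locally Lipschitz function $g$, the Clarke generalized gradient is $\nabla_Cg(x)=\mathrm{conv}\{\lim_i\nabla g(x_i):x_i\to x,\ \nabla g(x_i)\text{ exists}\}$. The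 normal cone is $N_{I^n}(x)=\{z:z^T(z'-x)\le0\ \forall z'\in I^n\}$. A point $x\in I^n$ is stationary for $F$ if $0\in\nabla_CF(x)+N_{I^n}(x)$. A CW attack sequence is generated from $x_0$ by the projected generalized gradient method $x_{k+1}=P(x_k-\alpha_kG_k)$, $G_k\in\nabla_CF(x_k)$, where $P$ is the orthogonal projection onto $I^n$ and $(\alpha_k)$ is a non-increasing sequence of positive numbers with $\alpha_k\to0$, $\sum_k\alpha_k=\infty$, $\sum_k\alpha_k^2<\infty$. The attack is called successful if the sequence converges to a limit $x^*\notin\mathcal{NF}$. *)

(* Defs.v *)
From HB Require Import structures.
From mathcomp Require Export all_boot all_order all_algebra.
From mathcomp Require Export all_classical all_reals all_analysis.
Import Order.TTheory GRing.Theory Num.Theory.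
Import numFieldNormedType.Exports.

Set Implicit Arguments.
Unset Strict Implicit.
Unset Printing Implicit Defensive.

Local Open Scope classical_set_scope.
Local Open Scope ring_scope.

Section Euclidean.
Context {R : realType} {n : nat}.
Implicit Types (x y z v : 'rV[R]_n) (A D : set 'rV[R]_n).

Definition cube : set 'rV[R]_n := [set x | forall i, 0 <= x 0 i <= 1].

Definition dotv x y : R := \sum_i x 0 i * y 0 i.

(* The library norm on row vectors is the sup norm, hence this definition. *)
Definition sqnorm2 x : R := \sum_i x 0 i ^+ 2.

(* [p] is the point of [D] nearest to [y] in Euclidean distance. *)
Definition is_proj D y p : Prop :=
  D p /\ forall z, D z -> sqnorm2 (y - p) <= sqnorm2 (y - z).

Definition conv A : set 'rV[R]_n := smallest (@convex_set R 'rV[R]_n) A.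

Definition convex_polytope A : Prop := exists s : seq 'rV[R]_n, A = conv [set` s].

Definition normal_cone D x : set 'rV[R]_n :=
  [set z | forall z', D z' -> dotv z (z' - x) <= 0].

(* Boundary of [A `<=` D] in the subspace topology, for a closed [D]. *)
Definition rel_boundary D A : set 'rV[R]_n :=
  D `&` closure A `&` closure (D `\` A).

Definition gradient (g : 'rV[R]_n -> R) x : 'rV[R]_n :=
  \row_i 'D_(delta_mx 0 i) g x.

(* Clarke generalized gradient of the restriction of [g] to [D]: gradients are
   taken at interior points of [D] only, so that it does not depend on the
   values of [g] outside [D]. *)
Definition clarke D (g : 'rV[R]_n -> R) x : set 'rV[R]_n :=
  conv [set v | exists u : nat -> 'rV[R]_n,
    [/\ forall i, D° (u i) /\ differentiable g (u i),
        u @ \oo --> x &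
        (fun i => gradient g (u i)) @ \oo --> v]].

Definition stationary D (g : 'rV[R]_n -> R) x : Prop :=
  D x /\ exists G N, [/\ clarke D g x G, normal_cone D x N & G + N = 0].

Definition step_sizes (alpha : nat -> R) : Prop :=
  [/\ forall k, 0 < alpha k,
      nonincreasing_seq alpha,
      alpha @ \oo --> (0 : R),
      series alpha @ \oo --> +oo &
      cvgn (series (fun k => alpha k ^+ 2))].

Definition proj_gradient_seq D (g : 'rV[R]_n -> R) x0 (x : nat -> 'rV[R]_n) :
    Prop :=
  x 0%N = x0 /\
  exists (alpha : nat -> R) (G : nat -> 'rV[R]_n),
    step_sizes alpha /\
    forall k, clarke D g (x k) (G k) /\
              is_proj D (x k - alpha k *: G k) (x k.+1).

End Euclidean.

Section Network.
Context {R : realType} {n c : nat}.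
Implicit Types (Z : 'rV[R]_n -> 'rV[R]_c) (t : 'I_c) (x : 'rV[R]_n).

(* Only the restriction of [Z] to the cube matters. *)
Definition relu_logits Z : Prop :=
  {within cube, continuous Z} /\
  exists (m : nat) (P : 'I_m -> set 'rV[R]_n),
    [/\ forall j, convex_polytope (P j),
        cube = \bigcup_j P j &
        forall j, exists (A : 'M[R]_(n, c)) (b : 'rV[R]_c),
          forall x, P j x -> Z x = x *m A + b].

Definition softmax (z : 'rV[R]_c) : 'rV[R]_c :=
  \row_i (expR (z 0 i) / \sum_j expR (z 0 j)).

(* The class map of the network [softmax \o Z]; [None] stands for class 0. *)
Definition kappa Z x : option 'I_c :=
  [pick i | [forall j, (j != i) ==> (softmax (Z x) 0 j < softmax (Z x) 0 i)]].

Definition feasible Z t : set 'rV[R]_n := cube `&` [set x | kappa Z x != Some t].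

Definition infeasible Z t : set 'rV[R]_n :=
  cube `&` [set x | kappa Z x = Some t].

(* For [2 <= c] the supremum is that of a nonempty finite set, i.e. a maximum. *)
Definition cw_f Z t x : R :=
  Num.max (Z x 0 t - sup [set Z x 0 i | i in [set i | i != t]]) 0.

Definition cw_objective Z t (a : R) x0 x : R :=
  sqnorm2 (x - x0) + a * cw_f Z t x.

Definition cw_attack Z t (a : R) (x0 : 'rV[R]_n) (x : nat -> 'rV[R]_n) : Prop :=
  proj_gradient_seq cube (cw_objective Z t a x0) x0 x.

End Network.

(* Main.v *)
Require Import Defs.
From mathcomp Require Import ring lra.
Import Order.TTheory GRing.Theory Num.Theory.
Import numFieldNormedType.Exports.

Set Implicit Arguments.
Unset Strict Implicit.
Unset Printing Implicit Defensive.

Local Open Scope classical_set_scope.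
Local Open Scope ring_scope.

(** Wherever [F] is differentiable in the interior of the cube, its gradient is
    [2 (u - x0) + w] with [w] in a finite set, so near the limit [xs] all the
    Clarke gradients lie, up to the vanishing translation [2 (x_k - xs)], in the
    compact convex set [clarke cube F xs].  The obtuse-angle property of the
    projection gives, for every [z] in the cube,
      [2 alpha_k <G_k, x_(k+1) - z> <= |x_k - z|^2 - |x_(k+1) - z|^2],
    which telescopes.  As [sum alpha_k] diverges, a cluster point [H] of the
    [alpha]-weighted means of the [G_k] satisfies [<H, xs - z> <= 0] for all
    [z], which is stationarity.  If [xs] were not on the boundary, [f] would
    vanish near [xs], so that [H = 2 (xs - x0)]; taking [z = x0] then gives
    [xs = x0], which is infeasible. *)

(** * The Euclidean inner product on row vectors *)

Section InnerProduct.
Context {R : realType} {n : nat}.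
Implicit Types (x y z v w : 'rV[R]_n).

Lemma dotvC x y : dotv x y = dotv y x.
Proof. by apply: eq_bigr => i _; rewrite mulrC. Qed.

Lemma dotvDl x y z : dotv (x + y) z = dotv x z + dotv y z.
Proof. by rewrite -big_split; apply: eq_bigr => i _; rewrite mxE mulrDl. Qed.

Lemma dotvZl (k : R) x y : dotv (k *: x) y = k * dotv x y.
Proof. by rewrite /dotv mulr_sumr; apply: eq_bigr => i _; rewrite mxE mulrA. Qed.

Lemma dotvDr x y z : dotv x (y + z) = dotv x y + dotv x z.
Proof. by rewrite dotvC dotvDl 2!(dotvC _ x). Qed.

Lemma dotvZr (k : R) x y : dotv x (k *: y) = k * dotv x y.
Proof. by rewrite dotvC dotvZl dotvC. Qed.

Lemma dotvNl x y : dotv (- x) y = - dotv x y.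
Proof. by rewrite -scaleN1r dotvZl mulN1r. Qed.

Lemma dotvNr x y : dotv x (- y) = - dotv x y.
Proof. by rewrite dotvC dotvNl dotvC. Qed.

Lemma dotv0l x : dotv 0 x = 0.
Proof. by rewrite -(scale0r 0) dotvZl mul0r. Qed.

Lemma sqnorm2E x : sqnorm2 x = dotv x x.
Proof. by apply: eq_bigr => i _; rewrite expr2. Qed.

Lemma sqnorm2_ge0 x : 0 <= sqnorm2 x.
Proof. by apply: sumr_ge0 => i _; exact: sqr_ge0. Qed.

Lemma sqnorm2D x y : sqnorm2 (x + y) = sqnorm2 x + dotv x y *+ 2 + sqnorm2 y.
Proof. by rewrite !sqnorm2E dotvDl !dotvDr (dotvC y x); ring. Qed.

Lemma sqnorm2_eq0 x : sqnorm2 x = 0 -> x = 0.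
Proof.
move/eqP; rewrite psumr_eq0 => [/allP x0|i _]; last exact: sqr_ge0.
apply/rowP => i; have := x0 i (mem_index_enum _).
by rewrite sqrf_eq0 mxE => /eqP.
Qed.

Lemma dotv_suml (I : Type) (r : seq I) (P : pred I) (f : I -> 'rV[R]_n) y :
  dotv (\sum_(i <- r | P i) f i) y = \sum_(i <- r | P i) dotv (f i) y.
Proof. by apply: (big_morph (dotv^~ y)) => [u v|]; rewrite ?dotvDl ?dotv0l. Qed.

Lemma cvg_dotv (T : Type) (F : set_system T) {FF : Filter F}
    (f g : T -> 'rV[R]_n) x y :
  f @ F --> x -> g @ F --> y -> (fun s => dotv (f s) (g s)) @ F --> dotv x y.
Proof.
move=> fx gy; apply: cvg_big => [p|i _]; first exact: add_continuous.
have coord (h : T -> 'rV[R]_n) z : h @ F --> z -> h r 0 i @[r --> F] --> z 0 i.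
  move=> hz; apply: (cvg_comp h (fun v : 'rV[R]_n => v 0 i) hz).
  exact: coord_continuous.
by apply: cvgM; exact: coord.
Qed.

Lemma continuous_dotv (T : topologicalType) (f g : T -> 'rV[R]_n) :
  continuous f -> continuous g -> continuous (fun s => dotv (f s) (g s)).
Proof. by move=> cf cg s; apply: cvg_dotv; [exact: cf|exact: cg]. Qed.

(* Along the moment curve (1, r, r^2, ...) each form is a nonzero polynomial. *)
Lemma exists_dotv_neq0 (I : finType) (w : I -> 'rV[R]_n) :
  (forall i, w i != 0) -> exists v, forall i, dotv v (w i) != 0.
Proof.
move=> w0; pose p := \prod_i rVpoly (w i).
have p0 : p != 0.
  apply/prodf_neq0 => i _; apply: contra (w0 i) => /eqP e.
  by rewrite -(rVpolyK (w i)) e linear0.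
have [r pr] : exists r, ~~ root p r.
  apply: contrapT => /forallNP all_root.
  (* The points [0, ..., size p - 1] would be [size p] distinct roots, one too many for a nonzero
     polynomial. *)
  pose s := [seq k%:R : R | k <- iota 0 (size p)].
  have : (size s < size p)%N.
    apply: max_poly_roots => //.
    - by apply/allP => r _; apply/negPn/negP; exact: all_root.
    - by rewrite map_inj_uniq ?iota_uniq//; exact: mulrIn (oner_neq0 R).
  by rewrite size_map size_iota ltnn.
exists (\row_j r ^+ j) => i; move: pr; apply: contra => /eqP e.
rewrite rootE horner_prod; apply/prodf_eq0; exists i => //.
rewrite horner_poly; apply/eqP; rewrite -[RHS]e; apply: eq_bigr => j _.
rewrite insubT// => lt_jn; rewrite mxE mulrC.
by congr (_ * w i _ _); exact: val_inj.
Qed.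

End InnerProduct.

(** * Gradients of functions given by finitely many quadratic formulas *)

Section Gradients.
Context {R : realType} {n : nat}.
Implicit Types (x y z u v w : 'rV[R]_n).

Lemma derive_gradient (g : 'rV[R]_n -> R) u v :
  differentiable g u -> 'D_v g u = dotv v (gradient g u).
Proof.
move=> dg; rewrite deriveE// {1}(matrix_sum_delta v) big_ord1 linear_sum.
by apply: eq_bigr => i _; rewrite linearZ/= mxE deriveE.
Qed.

(** The hypothesis on [d] says [phi h = phi 0 + d * h + o(h)]. The quadratic agrees with [phi] only
    at points accumulating at 0; letting [h] tend to 0 along them matches first the constant terms,
    then the linear ones. *)
Lemma slope_of_frequently_quadratic (phi : R -> R) (d A B C : R) :
  h^-1 * (phi h - phi 0) @[h --> 0^'] --> d ->
  (forall U, nbhs (0 : R)^' U ->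
     exists2 h, U h & phi h = A + B * h + C * h ^+ 2) ->
  d = B.
Proof.
move=> dphi freq.
have small (e : R) : 0 < e ->
    exists h, [/\ h != 0, `|h| < e, phi h = A + B * h + C * h ^+ 2 &
      `|phi h - phi 0 - d * h| <= e * `|h|].
  move=> e0; have U1 : \forall h \near (0:R)^', `|d - h^-1 * (phi h - phi 0)| < e.
    by move/cvgrPdist_lt : dphi; exact.
  have U2 : \forall h \near (0:R)^', `|h| < e.
    by apply: dnbhs0_lt.
  have U3 : \forall h \near (0:R)^', h != 0 by exact: nbhs_dnbhs_neq.
  have [h [h1 h2 h3] phiE] := freq _ (filterS3 _ (fun h => @And3 _ _ _) U1 U2 U3).
  exists h; split => //.
  have -> : phi h - phi 0 - d * h = - (d - h^-1 * (phi h - phi 0)) * h by field.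
  by rewrite normrM normrN ler_wpM2r// ltW.
have AE : A = phi 0.
  apply/eqP; rewrite -subr_eq0 -normr_le0; apply/ler_addgt0Pr => e e0.
  (* For [|h| <= 1] the estimate below is at most [|h|] times [|d| + |B| + |C| + 1], which [M]
     dominates. *)
  pose M := `|d| + `|B| + `|C| + 2.
  have M0 : 0 < M.
    rewrite /M; have := normr_ge0 d; have := normr_ge0 B.
    by have := normr_ge0 C; lra.
  pose e' := Num.min 1 (e / M).
  have e'0 : 0 < e' by rewrite lt_min ltr01 divr_gt0.
  have [h [h0 he hE hd]] := small _ e'0.
  have h1 : `|h| <= 1 by apply/ltW/(lt_le_trans he); rewrite ge_min lexx.
  have hM : `|h| * M <= e.
    by rewrite -ler_pdivlMr//; apply/ltW/(lt_le_trans he); rewrite ge_min lexx orbT.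
  have -> : A - phi 0 = (phi h - phi 0 - d * h) + (d * h - B * h - C * h ^+ 2).
    rewrite hE; ring.
  rewrite add0r; apply: (le_trans (ler_normD _ _)).
  have le1 : e' * `|h| <= `|h| * 1.
    by rewrite mulrC ler_wpM2l// ge_min lexx.
  have le2 : `|d * h - B * h - C * h ^+ 2| <= `|h| * (`|d| + `|B| + `|C|).
    apply: (le_trans (ler_normB _ _)).
    have : `|C * h ^+ 2| <= `|h| * `|C|.
      rewrite normrM normrX mulrC ler_wpM2r// expr2 ger_pMr// normr_gt0//.
    have : `|d * h - B * h| <= `|h| * (`|d| + `|B|).
      apply: (le_trans (ler_normB _ _)); rewrite !normrM; lra.
    lra.
  rewrite /M in hM; have := normr_ge0 h; lra.
apply/eqP; rewrite -subr_eq0 -normr_le0; apply/ler_addgt0Pr => e e0.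
(* With this choice [e' * (|C| + 1) = e] pays for both the derivative error and the quadratic
   term. *)
pose e' := e / (`|C| + 1).
have C1 : 0 < `|C| + 1 by rewrite ltr_wpDl.
have e'0 : 0 < e' by rewrite divr_gt0.
have [h [h0 he hE hd]] := small _ e'0.
have hp : 0 < `|h| by rewrite normr_gt0.
rewrite add0r -(ler_pM2r hp) -normrM.
have -> : (d - B) * h = - (phi h - phi 0 - d * h) + C * h ^+ 2.
  rewrite hE AE; ring.
apply: (le_trans (ler_normD _ _)); rewrite normrN.
have le1 : `|C * h ^+ 2| <= `|C| * e' * `|h|.
  by rewrite normrM normrX expr2 mulrA ler_wpM2r// ler_wpM2l// ltW.
have -> : e * `|h| = `|C| * e' * `|h| + e' * `|h|.
  by rewrite /e'; field; rewrite gt_eqF.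
by rewrite addrC lerD.
Qed.

(** The sets where the formulas hold may be arbitrary. If the gradient differed from every
    candidate, some direction [v] would be orthogonal to none of the differences; yet along [v] one
    of the finitely many formulas recurs arbitrarily close to [u], and it fixes the slope. *)
Lemma gradient_piecewise (I : finType) (g : 'rV[R]_n -> R) x0 u
    (w : I -> 'rV[R]_n) (b : I -> R) :
  (\forall y \near u, exists i, g y = sqnorm2 (y - x0) + dotv y (w i) + b i) ->
  differentiable g u -> exists i, gradient g u = 2 *: (u - x0) + w i.
Proof.
move=> pieces dg; pose e i := gradient g u - (2 *: (u - x0) + w i).
apply: contrapT => /forallNP ne.
have [i|v v0] := @exists_dotv_neq0 _ _ I e.
  by rewrite subr_eq0; apply/eqP/ne.
suff [i] : exists i, dotv v (gradient g u) = dotv v (2 *: (u - x0) + w i).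
  move: (v0 i) => /eqP; rewrite /e dotvDr dotvNr => vi eqv.
  by apply: vi; rewrite eqv subrr.
apply: contrapT => /forallNP slope_ne.
pose phi h := g (h *: v + u).
have dphi : h^-1 * (phi h - phi 0) @[h --> (0:R)^'] --> dotv v (gradient g u).
  rewrite -derive_gradient// {2}/phi scale0r add0r.
  exact: (diff_derivable (v := v) dg).
have line : h *: v + u @[h --> (0:R)^'] --> u.
  have : continuous (fun h : R => h *: v + u).
    by move=> h; apply: cvgD; [exact: scalel_continuous|exact: cvg_cst].
  move=> /(_ 0); rewrite /continuous_at scale0r add0r.
  by apply: cvg_trans; apply: cvg_app; exact: nbhs_dnbhs.
(* A formula that is not eventually avoided recurs for [h] arbitrarily close to 0, and then its
   linear coefficient is the slope of [phi]. *)
have avoided i : \forall h \near (0:R)^',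
    phi h <> sqnorm2 (h *: v + u - x0) + dotv (h *: v + u) (w i) + b i.
  apply: contrapT => not_avoided; apply: (slope_ne i).
  rewrite (@slope_of_frequently_quadratic phi _
    (sqnorm2 (u - x0) + dotv u (w i) + b i) (dotv v (2 *: (u - x0) + w i))
    (sqnorm2 v) dphi)// => U nU.
  apply: contrapT => avoid; apply: not_avoided.
  apply: filterS nU => h Uh phiE; apply: avoid; exists h => //.
  rewrite phiE; have -> : h *: v + u - x0 = (u - x0) + h *: v.
    by rewrite -addrA addrC.
  rewrite sqnorm2D (sqnorm2E (h *: v)) dotvZl !dotvZr -sqnorm2E.
  rewrite (dotvDl _ _ (w i)) dotvZl.
  by rewrite !dotvDr !dotvZr (dotvC (u - x0)) dotvDr; ring.
have [h [hpieces havoid]] : exists h, (exists i, phi h =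
    sqnorm2 (h *: v + u - x0) + dotv (h *: v + u) (w i) + b i) /\
    forall i, phi h <> sqnorm2 (h *: v + u - x0) + dotv (h *: v + u) (w i) + b i.
  apply: (@filter_ex _ (0:R)^').
  by apply: filterI; [exact: (line _ pieces)|exact: (filter_forall _ avoided)].
by case: hpieces => i; exact: havoid.
Qed.

End Gradients.

(** * Convex hulls, weighted means, and compactness of finitely generated hulls *)

Section Convexity.
Context {R : realType} {n : nat}.
Implicit Types (x y z v w : 'rV[R]_n) (A K : set 'rV[R]_n).

Lemma convex_setP A : convex_set A <->
  (forall x y (l : R), 0 <= l <= 1 -> A x -> A y -> A (l *: x + (1 - l) *: y)).
Proof.
split=> [cA x y l l01 Ax Ay|cA x y l].
  have := cA x y (Itv01 (andP l01).1 (andP l01).2).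
  by rewrite !inE => /(_ Ax Ay).
rewrite !inE => Ax Ay; apply: cA => //.
by rewrite ge0 le1.
Qed.

Lemma conv_sub A : A `<=` conv A.
Proof. exact: sub_smallest. Qed.

Lemma conv_min A K : convex_set K -> A `<=` K -> conv A `<=` K.
Proof. exact: smallest_sub. Qed.

Lemma convex_conv A : convex_set (conv A).
Proof.
apply/convex_setP => x y l l01 Ax Ay K [cK AK].
by move/convex_setP: (cK); apply => //; [exact: Ax|exact: Ay].
Qed.

Lemma convex_weighted_mean K (I : Type) (r : seq I) (l : I -> R)
    (v : I -> 'rV[R]_n) :
  convex_set K -> (forall i, 0 <= l i) -> (forall i, K (v i)) ->
  0 < \sum_(i <- r) l i ->
  K ((\sum_(i <- r) l i)^-1 *: \sum_(i <- r) l i *: v i).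
Proof.
move=> /convex_setP cK l0 Kv; elim: r => [|i r IH]; first by rewrite big_nil ltxx.
rewrite !big_cons; set s := \sum_(j <- r) _; set m := \sum_(j <- r) _ *: _.
have s0 : 0 <= s by exact: sumr_ge0.
(* A tail of total weight 0 escapes the induction hypothesis; all its weights vanish, and the mean
   is [v i] alone. *)
move=> ls0; have [s_eq0|s_neq0] := eqVneq s 0.
  have -> : m = 0.
    move: s_eq0 => /eqP; rewrite /s /m; elim: (r) => [|j q IHq].
      by rewrite !big_nil.
    rewrite !big_cons paddr_eq0// ?sumr_ge0// => /andP[/eqP-> /IHq ->].
    by rewrite scale0r addr0.
  rewrite s_eq0 !addr0 scalerA mulVf ?scale1r//.
  by rewrite gt_eqF//; move: ls0; rewrite s_eq0 addr0.
have sp : 0 < s by rewrite lt_neqAle eq_sym s_neq0.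
(* The mean over [i :: r] lies on the segment between [v i] and the mean over [r]. *)
have -> : (l i + s)^-1 *: (l i *: v i + m) =
    (l i / (l i + s)) *: v i + (1 - l i / (l i + s)) *: (s^-1 *: m).
  rewrite scalerDr !scalerA mulrC; congr (_ + _ *: _).
  by field; rewrite s_neq0 gt_eqF.
apply: cK => //; last exact: IH.
by rewrite divr_ge0 ?l0 ?(ltW ls0)//= ler_pdivrMr// mul1r lerDl.
Qed.

Lemma convex_translate K z : convex_set K -> convex_set [set y | K (y - z)].
Proof.
move=> /convex_setP cK; apply/convex_setP => x y l l01 /= Kx Ky.
have -> : l *: x + (1 - l) *: y - z = l *: (x - z) + (1 - l) *: (y - z).
  by rewrite !scalerBr !scalerBl !scale1r; apply/rowP => i; rewrite !mxE; ring.
exact: cK.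
Qed.

Lemma convex_set1 z : convex_set [set z].
Proof.
by apply/convex_setP => x y l _ /= -> ->; rewrite -scalerDl addrC subrK scale1r.
Qed.

(** Presents the hull as the image of the standard simplex, for the compactness proof. The
    combinations form a convex set containing each [v i]; conversely, each is a weighted mean of
    points of the hull. *)
Lemma conv_range N (v : 'I_N -> 'rV[R]_n) :
  conv (range v) = [set \sum_i l 0 i *: v i | l in
    [set l : 'rV[R]_N |
      (forall i, `[0, 1]%classic (l 0 i)) /\ \sum_i l 0 i = 1]].
Proof.
apply/seteqP; split.
  apply: conv_min => [|_ [i _ <-]].
    apply/convex_setP => _ _ k k01 [l [l01 l1] <-] [m [m01 m1] <-].
    exists (k *: l + (1 - k) *: m); first split => [i|].
    - rewrite !mxE; move: (l01 i) (m01 i); rewrite /= !in_itv/= => lb mb.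
      by move: k01 lb mb => /andP[? ?] /andP[? ?] /andP[? ?]; apply/andP; split; nra.
    - under eq_bigr do rewrite !mxE.
      by rewrite big_split/= -!mulr_sumr l1 m1; ring.
    - rewrite !scaler_sumr -big_split; apply: eq_bigr => i _ /=.
      by rewrite !mxE !scalerA -scalerDl.
  rewrite /=; exists (delta_mx 0 i); first split => [j|].
  - by rewrite /= in_itv/= mxE eqxx/=; case: eqP; rewrite !lexx ler01.
  - rewrite (bigD1 i)//= mxE !eqxx big1 ?addr0// => j /negbTE ji.
    by rewrite mxE ji andbF.
  - rewrite (bigD1 i)//= mxE !eqxx scale1r big1 ?addr0// => j /negbTE ji.
    by rewrite mxE ji andbF scale0r.
move=> _ [l [l01 l1] <-].
(* Inserts the factor [(\sum_i l 0 i)^-1 = 1] to obtain the shape of a weighted mean. *)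
rewrite -[X in conv _ X]scale1r -[X in X *: _]invr1 -{1}l1.
apply: convex_weighted_mean; first exact: convex_conv.
- by move=> i; move: (l01 i); rewrite /= in_itv => /andP[].
- by move=> i; apply: conv_sub; exists i.
- by rewrite l1.
Qed.

Lemma compact_conv_finite A : finite_set A -> compact (conv A).
Proof.
move=> /finite_seqP[s ->].
have -> : [set` s] = range (fun i : 'I_(size s) => s`_i).
  apply/seteqP; split=> [x /= xs|_ [i _ <-]]; last exact: mem_nth.
  have lt_xs : (index x s < size s)%N by rewrite index_mem.
  by exists (Ordinal lt_xs) => //=; rewrite nth_index.
rewrite conv_range; apply: continuous_compact.
  apply: continuous_subspaceT; apply: continuous_big => [p|i _ l].
    exact: add_continuous.
  apply: (@cvgZ _ _ _ _ _ (fun l : 'rV[R]_(size s) => l 0 i) (cst s`_i)).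
  - exact: (@nbhs_filter _ l).
  - exact: coord_continuous.
  - exact: (@cvg_cst _ s`_i _ (nbhs l)).
(* The simplex is the unit box cut by the closed hyperplane where the inner product with the
   all-ones vector is 1. *)
apply: compact_closedI.
  apply: (@rV_compact R _ (fun=> `[0, 1]%classic)) => i; exact: segment_compact.
have /continuous_closedP/(_ _ (@closed_eq R 1)) :
    continuous (fun l : 'rV[R]_(size s) => dotv l (const_mx 1)).
  by apply: continuous_dotv; [move=> l U|exact: cst_continuous].
congr closed; apply/funext => l /=; congr (_ = 1).
by apply: eq_bigr => i _; rewrite mxE mulr1.
Qed.

End Convexity.

(** * Limits of gradients and their upper semicontinuity *)

Section LimitingGradients.
Context {R : realType} {n : nat}.
Implicit Types (x y z u v : 'rV[R]_n) (D : set 'rV[R]_n) (g : 'rV[R]_n -> R).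

(** The generators of [clarke], before the hull is taken: finiteness arguments apply to them and not
    to the hull. *)
Definition limiting_gradients D g x : set 'rV[R]_n :=
  [set v | exists u : nat -> 'rV[R]_n,
    [/\ forall i, D° (u i) /\ differentiable g (u i),
        u @ \oo --> x &
        (fun i => gradient g (u i)) @ \oo --> v]].

Lemma cvg_ball_invS x (u : nat -> 'rV[R]_n) :
  (forall k, ball x k.+1%:R^-1 (u k)) -> u @ \oo --> x.
Proof.
move=> xu; apply/cvg_ballP => e e0; near=> k.
apply: (@le_ball _ _ x k.+1%:R^-1) => //.
by apply/ltW; near: k; exact: near_infty_natSinv_lt (PosNum e0).
Unshelve. all: by end_near. Qed.

(** Once [c] is subtracted, the gradients near [x] take values in a finite set, which is closed and
    so retains their limits. *)
Lemma limiting_gradients_sub (I : finType) D g x (c : 'rV[R]_n -> 'rV[R]_n)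
    (w : I -> 'rV[R]_n) (P : set I) :
  continuous c ->
  (\forall u \near x, D° u -> differentiable g u ->
    exists2 i, P i & gradient g u = c u + w i) ->
  limiting_gradients D g x `<=` [set c x + w i | i in P].
Proof.
move=> cc gradE v [u [Du ux uv]].
suff [i Pi wi] : (w @` P) (v - c x) by exists i => //; rewrite wi addrC subrK.
have fin : finite_set (w @` P) by exact/finite_image/finite_finset.
apply: (closed_cvg (u_ := fun k => gradient g (u k) - c (u k)) (F := \oo)).
- apply: (iffLR accessible_finite_set_closed) fin.
  exact/hausdorff_accessible/norm_hausdorff.
- have near_u : \forall k \near \oo, D° (u k) -> differentiable g (u k) ->
      exists2 i, P i & gradient g (u k) = c (u k) + w i := ux _ gradE.
  apply: filterS near_u => k /(_ (Du k).1 (Du k).2)[i Pi ->].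
  by exists i => //; rewrite addrC addKr.
- by apply: cvgB => //; exact: (cvg_comp u c ux (cc x)).
Qed.

(* Upper semicontinuity: only finitely many values of [gradient g - c] occur,
   and those occurring arbitrarily close to [x] are limits at [x]. *)
Lemma limiting_gradients_usc (I : finType) D g x (c : 'rV[R]_n -> 'rV[R]_n)
    (w : I -> 'rV[R]_n) :
  continuous c ->
  (forall u, D° u -> differentiable g u ->
    exists i, gradient g u = c u + w i) ->
  \forall y \near x, limiting_gradients D g y `<=`
    [set v | limiting_gradients D g x (v - c y + c x)].
Proof.
(* [P] collects the indices realised as limits at [x]. Any other index is absent near [x]: otherwise
   points chosen in the balls of radius [1/(k+1)] would realise it. *)
move=> cc gradE; pose P : set I := [set i | limiting_gradients D g x (c x + w i)].
have avoid i : \forall u \near x,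
    D° u -> differentiable g u -> gradient g u = c u + w i -> P i.
  have [Pi|nPi] := pselect (P i); first by apply: (@nearW _ (nbhs x)) => u _ _ _.
  apply: contrapT => not_avoid; apply: nPi.
  have seq k : exists u, [/\ ball x k.+1%:R^-1 u, D° u, differentiable g u &
      gradient g u = c u + w i].
    apply: contrapT => /forallNP none; apply: not_avoid.
    apply/nbhs_ballP; exists k.+1%:R^-1 => //= u xu Du dgu gu.
    by case: (none u).
  have [u uP] := choice seq.
  have ux : u @ \oo --> x by apply: cvg_ball_invS => k; case: (uP k).
  exists u; split=> // [k|]; first by case: (uP k).
  have -> : (fun k => gradient g (u k)) = (fun k => c (u k) + w i).
    by apply/funext => k; case: (uP k).
  apply: cvgD; last exact: cvg_cst.
  exact: (cvg_comp u c ux (cc x)).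
(* Limiting gradients at [y] involve points near [y], so the property is needed on a neighbourhood
   of each [y] near [x]. *)
have /near_join : \forall u \near x, D° u -> differentiable g u ->
    exists2 i, P i & gradient g u = c u + w i.
  apply: filterS (filter_forall _ avoid) => u uP Du dgu.
  by have [i gu] := gradE u Du dgu; exists i => //; exact: uP gu.
apply: filterS => y near_y v /(limiting_gradients_sub cc near_y)[i Pi <-] /=.
have -> : c y + w i - c y + c x = c x + w i by rewrite (addrC (c y)) addrK addrC.
exact: Pi.
Qed.

End LimitingGradients.

(** * Projected steps and weighted means of their directions *)

Section ProjectedSteps.
Context {R : realType} {n : nat}.
Implicit Types (x y z p v : 'rV[R]_n) (D K : set 'rV[R]_n).

(** Comparing [p] with the point at parameter [l] on the segment towards [z] gives
    [d *+ 2 <= l * s]; a small [l] excludes [0 < d]. *)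
Lemma proj_obtuse D y p z :
  convex_set D -> is_proj D y p -> D z -> dotv (y - p) (z - p) <= 0.
Proof.
move=> /convex_setP cD [Dp pmin] Dz.
set d := dotv _ _; pose s := sqnorm2 (z - p).
have s0 : 0 <= s by exact: sqnorm2_ge0.
have step (l : R) : 0 < l <= 1 -> d *+ 2 <= l * s.
  move=> /andP[l0 l1].
  have := pmin _ (cD z p l _ Dz Dp); rewrite ltW//= => /(_ l1).
  have -> : y - (l *: z + (1 - l) *: p) = (y - p) + (- l) *: (z - p).
    by apply/rowP => i; rewrite !mxE; ring.
  rewrite (sqnorm2D (y - p)) (sqnorm2E (_ *: _)) dotvZl !dotvZr -sqnorm2E -/d -/s => h.
  by rewrite -(ler_pM2l l0); lra.
rewrite leNgt; apply/negP => d0.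
(* This [l] is at most 1 and satisfies [l * s <= d]; the [+ 1] keeps the denominator positive when
   [z = p]. *)
have := step (Num.min 1 (d / (s + 1))).
rewrite lt_min ltr01 ge_min lexx divr_gt0 ?ltr_wpDl//= => /(_ isT).
have : Num.min 1 (d / (s + 1)) * s <= d.
  apply: (@le_trans _ _ (d / (s + 1) * s)).
    by rewrite ler_wpM2r// ge_min lexx orbT.
  by rewrite mulrAC ler_pdivrMr ?ltr_wpDl// ler_wpM2l ?lerDl// ltW.
lra.
Qed.

(** Expand the square of [(x - p) + (p - z)]: the obtuse angle bounds the cross term from below, and
    [sqnorm2 (x - p)] is nonnegative. *)
Lemma proj_step_descent D (a : R) x v p z :
  convex_set D -> is_proj D (x - a *: v) p -> D z ->
  a * dotv v (p - z) *+ 2 <= sqnorm2 (x - z) - sqnorm2 (p - z).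
Proof.
move=> cD pp Dz; have := proj_obtuse cD pp Dz.
have -> : x - z = (x - p) + (p - z) by rewrite addrA subrK.
have -> : x - a *: v - p = (x - p) - a *: v by rewrite addrAC.
rewrite -(opprB p z) dotvNr dotvDl dotvNl dotvZl (sqnorm2D (x - p)).
have := sqnorm2_ge0 (x - p); lra.
Qed.

(** Half of [e] absorbs the late errors, each at most [e / 2]; the other half absorbs [C] and the
    finitely many early errors, which stay fixed while the total weight diverges. *)
Lemma weighted_mean_limsup (alpha beta eta : nat -> R) (C : R) :
  (forall k, 0 < alpha k) -> series alpha @ \oo --> +oo ->
  eta @ \oo --> (0 : R) ->
  (forall N, \sum_(0 <= k < N) alpha k * beta k <=
    C + \sum_(0 <= k < N) alpha k * eta k) ->
  forall e, 0 < e -> \forall N \near \oo,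
    (series alpha N)^-1 * \sum_(0 <= k < N) alpha k * beta k <= e.
Proof.
move=> alpha0 alphaoo eta0 bound e e0.
have e20 : 0 < e / 2 by rewrite divr_gt0.
have [M _ etaM] : \forall k \near \oo, eta k <= e / 2.
  have /cvgrPdist_le/(_ _ e20) := eta0.
  apply: filterS => k; rewrite sub0r normrN; exact/le_trans/ler_norm.
pose B := \sum_(0 <= k < M) alpha k * `|eta k|.
near=> N.
have MN : (M <= N)%N by near: N; exact: nbhs_infty_ge.
(* The 1 makes the total weight positive; the quotient makes [|C| + B] at most [e / 2] times that
   weight. *)
have large : 1 + (`|C| + B) / (e / 2) <= series alpha N.
  by near: N; move/cvgryPge : alphaoo; exact.
have B0 : 0 <= B by apply: sumr_ge0 => k _; rewrite mulr_ge0// ltW.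
have A0 : 0 < series alpha N.
  apply: lt_le_trans large.
  by rewrite ltr_wpDr ?ltr01// divr_ge0 ?addr_ge0 ?(ltW e20)//.
rewrite mulrC ler_pdivrMr//; apply: (le_trans (bound N)).
have tail : \sum_(0 <= k < N) alpha k * eta k <= B + e / 2 * series alpha N.
  rewrite (big_cat_nat (n := M))//= seriesEnat/= mulr_sumr.
  rewrite [in leRHS](big_cat_nat (n := M))//= addrA.
  apply: lerD; last first.
    rewrite big_nat_cond [leRHS]big_nat_cond; apply: ler_sum => k /andP[/andP[Mk _] _].
    by rewrite mulrC ler_wpM2r ?(ltW (alpha0 k))//; exact: etaM.
  rewrite ler_wpDr ?sumr_ge0// => [k _|]; first by rewrite mulr_ge0// ltW.
  by apply: ler_sum => k _; rewrite ler_wpM2l ?ler_norm// ltW.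
have CB : `|C| + B <= e / 2 * series alpha N.
  rewrite -ler_pdivrMl// mulrC; apply: le_trans large; lra.
have := ler_norm C; lra.
Unshelve. all: by end_near. Qed.

Lemma dotv_bounded_cvg0 K (H y : nat -> 'rV[R]_n) :
  compact K -> (forall k, K (H k)) -> y @ \oo --> (0 : 'rV[R]_n) ->
  (fun k => dotv (H k) (y k)) @ \oo --> (0 : R).
Proof.
move=> /compact_bounded[M0 [_ /(_ (M0 + 1))]].
rewrite ltrDl ltr01 => /(_ isT) KM KH y0.
have HM k i : `|H k 0 i| <= M0 + 1.
  apply: le_trans (KM _ (KH k)).
  by rewrite /Num.norm/= mx_normrE (le_bigmax _ (fun ij => `|H k ij.1 ij.2|) (0, i)).
have -> : (0 : R) = \sum_(i < n) 0 by rewrite big1.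
apply: cvg_big => [|i _]; first exact: add_continuous.
apply/norm_cvg0P.
apply: (@squeeze_cvgr _ _ _ _ (cst 0) (fun k => (M0 + 1) * `|y k 0 i|)).
- by apply: nearW => k; rewrite normr_ge0 normrM ler_wpM2r.
- exact: cvg_cst.
- have -> : (0 : R) = (M0 + 1) * `|(0 : 'rV[R]_n) 0 i| by rewrite mxE normr0 mulr0.
  apply: cvgMr; apply: cvg_norm.
  apply: (cvg_comp y (fun v : 'rV[R]_n => v 0 i) y0).
  exact: (@coord_continuous R 1 n 0 i 0).
Qed.

(** The directions [G k] only approach [K]. Averaging the companions [H k] instead keeps the means
    in a compact convex set, at the cost of a vanishing error. *)
Lemma proj_gradient_limit D K (x G : nat -> 'rV[R]_n) (alpha : nat -> R)
    (xs : 'rV[R]_n) :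
  convex_set D -> convex_set K -> compact K ->
  (forall k, 0 < alpha k) -> series alpha @ \oo --> +oo ->
  x @ \oo --> xs ->
  (forall k, is_proj D (x k - alpha k *: G k) (x k.+1)) ->
  (exists2 H : nat -> 'rV[R]_n, forall k, K (H k) &
    (fun k => G k - H k) @ \oo --> (0 : 'rV[R]_n)) ->
  exists2 H, K H & normal_cone D xs (- H).
Proof.
move=> cD cK compK alpha0 alphaoo xxs xproj [H KH GH].
pose Hbar N := (series alpha N)^-1 *: \sum_(0 <= k < N) alpha k *: H k.
(* The total weight is 0 at [N = 0]; once it is at least 1, the mean is a genuine convex
   combination. *)
have KHbar : \forall N \near \oo, K (Hbar N).
  have /cvgryPge/(_ 1) := alphaoo.
  apply: filterS => N aN; apply: convex_weighted_mean => //.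
    by move=> k; exact: ltW.
  exact: lt_le_trans aN.
have [H0 [KH0 clH0]] := compK (Hbar @ \oo) _ KHbar.
exists H0 => // z Dz; rewrite dotvNl -dotvNr opprB.
have bound (e : R) : 0 < e -> dotv H0 (xs - z) <= e.
  move=> e0.
  have clos : closed [set h | dotv h (xs - z) <= e].
    have /continuous_closedP : continuous (fun h => dotv h (xs - z)).
      by apply: continuous_dotv; [move=> h U|exact: cst_continuous].
    by move=> /(_ _ (@closed_le R e)).
  (* A closed set that eventually contains the means contains their cluster point. *)
  apply: clos; move: clH0; rewrite clusterE; apply.
  (* The initial term of the telescoping sum, halved because the descent inequality bounds twice the
     inner product. *)
  pose C := sqnorm2 (x 0%N - z) / 2.
  (* The error of passing to [H k] and [xs]. It splits into a bounded factor against a vanishing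
     one, and a vanishing factor against a convergent one. *)
  pose eta k := dotv (H k) (xs - z) - dotv (G k) (x k.+1 - z).
  have etaE k : eta k = - dotv (H k) (x k.+1 - xs) - dotv (G k - H k) (x k.+1 - z).
    by rewrite /eta !(dotvDl, dotvDr, dotvNl, dotvNr); ring.
  have xS : (fun k => x k.+1) @ \oo --> xs by rewrite (cvg_shiftS x).
  have eta0 : eta @ \oo --> (0 : R).
    rewrite (funext etaE) -[X in _ --> X](subrr (0 : R)) -{1}oppr0.
    apply: cvgB.
      apply: cvgN; apply: (dotv_bounded_cvg0 compK KH).
      by rewrite -(subrr xs); apply: cvgB => //; exact: cvg_cst.
    rewrite -(dotv0l (xs - z)); apply: cvg_dotv => //.
    by apply: cvgB => //; exact: cvg_cst.
  have sum_bound N : \sum_(0 <= k < N) alpha k * dotv (H k) (xs - z) <=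
      C + \sum_(0 <= k < N) alpha k * eta k.
    rewrite -lerBlDr -sumrB.
    have -> : \sum_(0 <= k < N) (alpha k * dotv (H k) (xs - z) - alpha k * eta k) =
        \sum_(0 <= k < N) alpha k * dotv (G k) (x k.+1 - z).
      by apply: eq_bigr => k _; rewrite /eta; ring.
    suff : \sum_(0 <= k < N) alpha k * dotv (G k) (x k.+1 - z) <=
      C - sqnorm2 (x N - z) / 2 by have := sqnorm2_ge0 (x N - z); lra.
    elim: N => [|N IH]; first by rewrite big_geq// subrr.
    rewrite big_nat_recr//=.
    have := proj_step_descent cD (xproj N) Dz; lra.
  apply: filterS (weighted_mean_limsup alpha0 alphaoo eta0 sum_bound e0) => N /=.
  rewrite dotvZl dotv_suml.
  by under [in X in _ -> X]eq_bigr do rewrite dotvZl.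
by apply/ler_addgt0Pr => e e0; rewrite add0r; exact: bound.
Qed.

End ProjectedSteps.

(** * Stationarity of limits of projected gradient sequences *)

Section Stationarity.
Context {R : realType} {n : nat}.
Implicit Types (x y z u v : 'rV[R]_n) (D : set 'rV[R]_n) (g : 'rV[R]_n -> R).

(** Upper semicontinuity holds only near [xs], so the sequence is restarted at an index [N] past
    which it applies; the step sizes of the tail still have divergent sum. *)
Lemma proj_gradient_seq_limit (I : finType) D g x0 (x : nat -> 'rV[R]_n) xs
    (c : 'rV[R]_n -> 'rV[R]_n) (w : I -> 'rV[R]_n) :
  convex_set D -> continuous c ->
  (forall u, D° u -> differentiable g u ->
    exists i, gradient g u = c u + w i) ->
  proj_gradient_seq D g x0 x -> x @ \oo --> xs ->
  exists2 H, clarke D g xs H & normal_cone D xs (- H).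
Proof.
move=> cD cc gradE [_ [alpha [G [[alpha0 _ _ alphaoo _] step]]]] xxs.
have [N _ usc] : \forall k \near \oo, limiting_gradients D g (x k) `<=`
    [set v | limiting_gradients D g xs (v - c (x k) + c xs)] :=
  xxs _ (limiting_gradients_usc xs cc gradE).
have finK : finite_set (limiting_gradients D g xs).
  have gradE' : \forall u \near xs, D° u -> differentiable g u ->
      exists2 i, [set: I] i & gradient g u = c u + w i.
    apply: (@nearW _ (nbhs xs)) => u Du dgu.
    by have [i gu] := gradE u Du dgu; exists i.
  apply: sub_finite_set (limiting_gradients_sub cc gradE') _.
  exact/finite_image/finite_finset.
have xNxs : (fun k => x (k + N)%N) @ \oo --> xs by rewrite (cvg_shiftn N).
apply: (@proj_gradient_limit _ _ _ _ (fun k => x (k + N)%N)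
  (fun k => G (k + N)%N) (fun k => alpha (k + N)%N) _ cD).
- exact: convex_conv.
- exact: compact_conv_finite finK.
- by [].
- have -> : series (fun k => alpha (k + N)%N) =
      (fun k => - series alpha N + series alpha (k + N)%N).
    apply/funext => k; rewrite series_addn addKr seriesEnat/=.
    by rewrite -{2}[N]add0n big_addn addnK.
  have alphaNoo : (fun k => series alpha (k + N)%N) @ \oo --> +oo.
    by rewrite (cvg_shiftn N (series alpha)).
  apply/cvgryPge => A; have /cvgryPge/(_ (A + series alpha N)) := alphaNoo.
  by apply: filterS => k; lra.
- exact: xNxs.
- by move=> k; exact: (step (k + N)%N).2.
(* Undoing the translation brings each direction into the generalized gradient at [xs]; by
   continuity of [c] the translation tends to 0. *)
- exists (fun k => G (k + N)%N - (c (x (k + N)%N) - c xs)) => [k|].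
    pose K := [set v | clarke D g xs (v - (c (x (k + N)%N) - c xs))].
    (* The translated hull [K] is convex, so it is enough that it contains the generators. *)
    move: (step (k + N)%N).1; apply: (@conv_min _ _ _ K).
      apply: convex_translate; exact: convex_conv.
    move=> v /(usc _ (leq_addl _ _)) /= vK; apply: conv_sub.
    by rewrite opprB addrCA addrC.
  under eq_cvg do rewrite subKr.
  rewrite -(subrr (c xs)); apply: cvgB; last exact: cvg_cst.
  exact: (cvg_comp (fun k => x (k + N)%N) c xNxs (cc xs)).
Qed.

End Stationarity.

(** * Logits, the class map and the attack objective on the cube *)

Section Network.
Context {R : realType} {n c : nat}.
Implicit Types (Z : 'rV[R]_n -> 'rV[R]_c) (t : 'I_c) (x y : 'rV[R]_n).

Lemma convex_cube : convex_set (cube : set 'rV[R]_n).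
Proof.
apply/convex_setP => x y l /andP[l0 l1] xc yc i; rewrite !mxE.
by have /andP[? ?] := xc i; have /andP[? ?] := yc i; apply/andP; split; nra.
Qed.

Lemma cube_lim (x : nat -> 'rV[R]_n) xs :
  (forall k, cube (x k)) -> x @ \oo --> xs -> cube xs.
Proof.
move=> xc xxs i; suff : `[0, 1]%classic (xs 0 i) by rewrite /= in_itv.
apply: (@closed_cvg _ _ \oo _ (fun k => x k 0 i)).
- exact: itv_closed.
- by apply: nearW => k; rewrite /= in_itv/=; exact: xc.
- apply: (cvg_comp x (fun v : 'rV[R]_n => v 0 i) xxs).
  exact: (@coord_continuous R 1 n 0 i xs).
Qed.

Lemma softmax_lt (z : 'rV[R]_c) i j :
  (softmax z 0 i < softmax z 0 j) = (z 0 i < z 0 j).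
Proof.
rewrite !mxE ltr_pM2r ?ltr_expR// invr_gt0.
rewrite (bigD1 i)//= ltr_wpDr ?expR_gt0// sumr_ge0// => k _; exact: expR_ge0.
Qed.

(** [softmax] divides increasing exponentials by a common positive sum, so classes are read off the
    logits. *)
Lemma kappaP Z t x :
  kappa Z x = Some t <-> forall j, j != t -> Z x 0 j < Z x 0 t.
Proof.
rewrite /kappa; case: pickP => [i /forallP iP|none]; split=> //.
- by case=> <- j ji; have /implyP/(_ ji) := iP j; rewrite softmax_lt.
- move=> tP; congr Some; apply/eqP; apply: contraT => it.
  have /implyP := iP t; rewrite eq_sym softmax_lt => /(_ it).
  by rewrite ltNge ltW//; exact: tP.
- move=> tP; have /negP[] := none t; apply/forallP => j; apply/implyP => jt.
  by rewrite softmax_lt; exact: tP.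
Qed.

(** With at least two classes the set under [sup] is nonempty and finite, so the supremum is
    attained and is not the default value of [sup] on the empty set. *)
Lemma sup_other_logits Z t x : (2 <= c)%N -> exists i,
  [/\ i != t, sup [set Z x 0 i | i in [set i | i != t]] = Z x 0 i &
      forall j, j != t -> Z x 0 j <= Z x 0 i].
Proof.
move=> c2; have [i0 i0t] : exists i0 : 'I_c, i0 != t.
  have /card_gt0P[i0] : (0 < #|predC1 t|)%N.
    by rewrite cardC1 card_ord -ltnS prednK// ltnW.
  by rewrite inE; exists i0.
have [i it imax] := @arg_maxP _ _ _ i0 (fun i => i != t) (fun i => Z x 0 i) i0t.
exists i; split=> //; apply/eqP; rewrite eq_le; apply/andP; split.
- by apply: ge_sup; [exists (Z x 0 i), i|move=> _ [j jt <-]; exact: imax].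
- apply: ub_le_sup; last by exists i.
  by exists (Z x 0 i) => _ [j jt <-]; exact: imax.
Qed.

Lemma cw_f_eq0 Z t x : (2 <= c)%N -> kappa Z x != Some t -> cw_f Z t x = 0.
Proof.
move=> c2 xt; have [i [it supE imax]] := sup_other_logits Z t x c2.
apply/max_idPr; rewrite supE subr_le0 leNgt; apply: contra xt => lt_it.
by apply/eqP/kappaP => j /imax ji; exact: le_lt_trans lt_it.
Qed.

(** A polytope and a largest competing logit determine the affine formula of the penalty; [None]
    labels the formula at points where the penalty vanishes. *)
Lemma cw_objective_piecewise Z t (a : R) x0 : (2 <= c)%N -> relu_logits Z ->
  exists (I : finType) (w : I -> 'rV[R]_n) (b : I -> R), forall x, cube x ->
    exists i, cw_objective Z t a x0 x = sqnorm2 (x - x0) + dotv x (w i) + b i.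
Proof.
move=> c2 [_ [m [P [_ cubeE affine]]]].
have [A /choice[b ZE]] := choice affine.
pose slope j i := (col t (A j) - col i (A j))^T.
exists (option ('I_m * 'I_c)),
  (oapp (fun ji => a *: slope ji.1 ji.2) 0),
  (oapp (fun ji => a * (b ji.1 0 t - b ji.1 0 ji.2)) 0) => x.
rewrite {1}cubeE => -[j _ Pjx].
rewrite /cw_objective /cw_f; have [i [_ -> _]] := sup_other_logits Z t x c2.
have [f0|f0] := leP (Z x 0 t - Z x 0 i) 0.
  by exists None; rewrite /= dotvC dotv0l mulr0 !addr0.
exists (Some (j, i)); rewrite /= -addrA; congr (_ + _).
rewrite dotvZr -mulrDr; congr (_ * _).
have coord k : Z x 0 k = dotv x (col k (A j))^T + b j 0 k.
  by rewrite (ZE j x Pjx) !mxE; congr (_ + _); apply: eq_bigr => l _; rewrite !mxE.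
rewrite !coord /slope linearB/= dotvDr dotvNr; ring.
Qed.

End Network.

Theorem lemma2 (R : realType) (n c : nat) (hn : (1 <= n)%N) (hc : (2 <= c)%N)
    (Z : 'rV[R]_n -> 'rV[R]_c) (hZ : relu_logits Z)
    (x0 : 'rV[R]_n) (hx0 : cube x0) (t : 'I_c) (ht : kappa Z x0 = Some t) :
  exists2 a0 : R, 0 < a0 & forall a : R, a0 <= a ->
    forall (x : nat -> 'rV[R]_n) (xs : 'rV[R]_n),
      cw_attack Z t a x0 x ->
      x @ \oo --> xs ->
      ~ infeasible Z t xs ->
      stationary cube (cw_objective Z t a x0) xs /\
      rel_boundary cube (feasible Z t) xs.
Proof.
exists 1; first exact: ltr01.
move=> a _ x xs attack xxs xs_feas; set F := cw_objective _ _ _ _.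
have [I [w [b pieces]]] := cw_objective_piecewise t a x0 hc hZ.
pose ct (u : 'rV[R]_n) := 2 *: (u - x0).
have cct : continuous ct.
  have cB : continuous (fun u : 'rV[R]_n => u - x0).
    move=> u.
    exact: (cvgB (F := nbhs u) (f := id) (g := cst x0) cvg_id (cvg_cst x0)).
  by move=> u; exact: (cvgZl_tmp (F := nbhs u) (cB u)).
have gradE u : cube° u -> differentiable F u -> exists i, gradient F u = ct u + w i.
  move=> cu dF; apply: (@gradient_piecewise _ _ _ _ _ _ w b) => //.
  by apply: filterS cu => y; exact: pieces.
have xs_cube : cube xs.
  case: attack => x00 [al [G [_ step]]]; apply: cube_lim xxs => -[|k].
    by rewrite x00.
  by case: (step k) => _ [].
have [H clH nH] := proj_gradient_seq_limit convex_cube cct gradE attack xxs.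
split; first by split=> //; exists H, (- H); rewrite subrr.
have xst : kappa Z xs != Some t by apply/eqP => xst; exact: xs_feas.
split; first by split=> //; exact: subset_closure.
apply: contrapT => not_closure.
have near_feas : \forall y \near xs, cube y -> kappa Z y != Some t.
  apply: contrapT => not_near; apply: not_closure => U xsU.
  apply: contrapT => empty; apply: not_near.
  apply: filterS xsU => y Uy cy; apply/negP => yt; apply: empty.
  by exists y; split=> //; split=> // -[_ /=]; rewrite yt.
(* Near [xs] the penalty vanishes on the cube, so a single formula with zero slope describes [F]
   there. *)
have limE : limiting_gradients cube F xs `<=` [set ct xs].
  have gradE0 : \forall u \near xs, cube° u -> differentiable F u ->
      exists2 i, [set: unit] i & gradient F u = ct u + (fun=> 0) i.
    have := near_join near_feas; apply: filterS => u near_u cu dF.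
    have [|[] gu] := @gradient_piecewise _ _ unit F x0 u (fun=> 0) (fun=> 0) _ dF.
      apply: filterS2 near_u cu => y yt cy; exists tt.
      by rewrite /F /cw_objective cw_f_eq0 ?yt// mulr0 dotvC dotv0l !addr0.
    by exists tt.
  by move=> v /(limiting_gradients_sub cct gradE0)[_ _ <-]; rewrite addr0.
have HE : H = ct xs.
  have : [set ct xs] H by apply: conv_min clH; [exact: convex_set1|exact: limE].
  by [].
(* Testing the normal cone at [x0] gives [2 |xs - x0|^2 <= 0]. *)
have xsx0 : xs - x0 = 0.
  apply: sqnorm2_eq0; apply/le_anti; rewrite sqnorm2_ge0 andbT.
  have := nH _ hx0; rewrite HE /ct dotvNl -dotvNr opprB dotvZl -sqnorm2E; lra.
by move: xst; rewrite (subr0_eq xsx0) ht eqxx.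
Qed.
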